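(* If $\overline{\beta} > 0$ and $\underline{\gamma} < 0$, then every point $(x,u,y,z,t) \in T$ with $y > 0$ satisfies $$(\overline{\gamma} - \underline{\gamma})y + \overline{\beta}(\overline{\gamma} x - u) + \frac{\underline{\gamma}\, y(u - \underline{\gamma} x)}{y + u - \underline{\gamma} x} \leq \overline{\beta} ( \overline{\gamma} - t ).$$
   Context: Let $\underline{\gamma} \le \overline{\gamma}$ and $\underline{\beta} \le \overline{\beta}$ be real parameters. The set $T \subseteq \mathbb{R}^5$ consists of all $(x,u,y,z,t)$ satisfying $$u = x t,\quad y + u \le 0,\quad z + x \le 1,\quad y \le \overline{\beta} z,\quad y \ge \underline{\beta} z,\quad z \ge 0,\quad x \in [0,1],\quad t \in [\underline{\gamma}, \overline{\gamma}].$$ *)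

(* Defs.v *)
From mathcomp Require Import all_boot all_order all_algebra.
From mathcomp Require Import classical_sets reals.
Set Implicit Arguments.
Unset Strict Implicit.
Unset Printing Implicit Defensive.
Import Order.TTheory GRing.Theory Num.Theory.
Local Open Scope ring_scope.
Local Open Scope classical_set_scope.

(* glo, ghi are the bounds on t, and blo, bhi the bounds on the ratio of y to z;
   the coordinates of a point are in the order (x, u, y, z, t). *)
Definition T (R : realType) (glo ghi blo bhi : R) : set (R * R * R * R * R) :=
  [set p | let: (x, u, y, z, t) := p in
    [/\ u = x * t, y + u <= 0 & z + x <= 1] /\
    [/\ y <= bhi * z, blo * z <= y & 0 <= z] /\
    x \in `[0, 1]%R /\ t \in `[glo, ghi]%R].

(* Main.v *)
Require Import Defs.
From mathcomp Require Import all_boot all_order all_algebra.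
From mathcomp Require Import classical_sets reals.
From mathcomp Require Import lra.
Import Order.TTheory GRing.Theory Num.Theory.
Local Open Scope ring_scope.
Local Open Scope classical_set_scope.

(** Put w = u - glo x = x (t - glo), which is nonnegative.  Moving the term
    bhi (ghi x - u) = bhi x (ghi - t) to the right turns the claim into
    (ghi - glo) y + glo y w / (y + w) <= bhi (1 - x) (ghi - t).
    Since y <= bhi z <= bhi (1 - x) and t <= ghi, the right-hand side is at
    least y (ghi - t), so after dividing by y > 0 it suffices that
    glo w / (y + w) <= glo - t.  Clearing the positive denominator, this says
    (t - glo) (y + w + glo x) <= 0, and y + w + glo x = y + u <= 0. *)

Theorem theorem3p3 (R : realType) (glo ghi blo bhi : R)
    (hg : glo <= ghi) (hb : blo <= bhi) (hbhi : 0 < bhi) (hglo : glo < 0)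
    (x u y z t : R) (hT : T glo ghi blo bhi (x, u, y, z, t)) (hy : 0 < y) :
  (ghi - glo) * y + bhi * (ghi * x - u)
    + glo * y * (u - glo * x) / (y + u - glo * x)
  <= bhi * (ghi - t).
Proof.
move: hT => [[-> hyu hzx] [[hyz _ _] []]].
rewrite !in_itv /= => /andP[x_ge0 _] /andP[t_ge t_le].
have w_ge0 : 0 <= x * (t - glo) by rewrite mulr_ge0 ?subr_ge0.
have D_gt0 : 0 < y + x * t - glo * x by lra.
have y_le : y <= bhi * (1 - x).
  by apply: le_trans hyz _; rewrite ler_pM2l //; lra.
have y_gap : y * (ghi - t) <= bhi * (1 - x) * (ghi - t).
  by rewrite ler_wpM2r ?subr_ge0.
have ratio_le : glo * (x * t - glo * x) / (y + x * t - glo * x) <= glo - t.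
  rewrite ler_pdivrMr //.
  have : (t - glo) * (y + x * t) <= 0 by rewrite mulr_ge0_le0 ?subr_ge0.
  lra.
have := ler_wpM2l (ltW hy) ratio_le.
rewrite mulrA [y * (glo * _)]mulrA [y * glo]mulrC.
lra.
Qed.
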